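(* The categories of cubes $\square$, $\square_S$, $\widehat{\square}$ and $\overline{\square}$ are thick.
   Context: For $n\geq 0$, $[n]=\{0<1\}^n$ with the product order, $[0]=\{()\}$. $\mathbf{PoSet}^+$ is the category of posets and strictly increasing maps. For $1\leq i\leq n$ and $\alpha\in\{0,1\}$, the coface map $\delta_i^\alpha:[n-1]\to[n]$ is $\delta_i^\alpha(x_1,\dots,x_{n-1})=(x_1,\dots,x_{i-1},\alpha,x_i,\dots,x_{n-1})$. $\square$ is the subcategory of $\mathbf{PoSet}^+$ with objects the $[n]$, $n\ge 0$, generated by the coface maps. For $x,x'\in[n]$ put $\vec d_1(x,x')=\sum_i|x_i-x'_i|$ if $x\leq x'$ and $\vec d_1(x,x')=\infty$ otherwise. A strictly increasing map $f:[m]\to[n]$ is cotransverse if for all $x,y\in[m]$, $\vec d_1(x,y)=1$ implies $\vec d_1(f(x),f(y))=1$. $\widehat{\square}_S$ is the category with objects the $[n]$, $n\geq 0$, and morphisms the cotransverse maps. A category of cubes is a small category $\mathcal{A}$ with $\square\subset\mathcal{A}\subset\widehat{\square}_S$ (same objects). Known fact: every cotransverse map $f:[m]\to[n]$ factors uniquely as $f=\phi\psi$ with $\psi:[m]\to[m]$ cotransverse and $\phi:[m]\to[n]$ in $\square$. A category of cubes $\mathcal{A}$ is thick if for every $f\in\mathcal{A}$, the map $\psi$ in this factorization belongs to $\mathcal{A}$. For $n\geq 2$ and $1\leq i\leq n-1$: $\sigma_i:[n]\to[n]$ is the symmetry map $\sigma_i(x_1,\dots,x_n)=(x_1,\dots,x_{i-1},x_{i+1},x_i,x_{i+2},\dots,x_n)$,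 and $\gamma_i:[n]\to[n]$ is $\gamma_i(x_1,\dots,x_n)=(x_1,\dots,x_{i-1},\max(x_i,x_{i+1}),\min(x_i,x_{i+1}),x_{i+2},\dots,x_n)$. $\square_S$ is the category of cubes generated by the $\delta_i^\alpha$ and the $\sigma_i$; $\overline{\square}$ is the category of cubes generated by the $\delta_i^\alpha$, the $\sigma_i$ and the $\gamma_i$. $\widehat{\square}$ is the category of cubes whose maps are the $\phi:[m]\to[n]$ in $\widehat{\square}_S$ such that for every $\delta:[p]\to[m]$ in $\square$, if $\phi\delta$ is one-to-one then $\phi\delta\in\square$. *)

(* Defs.v *)
From mathcomp Require Import all_boot all_order all_algebra.

Set Implicit Arguments.
Unset Strict Implicit.
Unset Printing Implicit Defensive.

Import Order.TTheory.
Local Open Scope nat_scope.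

(* The poset [n] = {0 < 1}^n with the product order; 0 and 1 are false and
   true. *)
Notation cube n := (n.-tupleprod bool).

(* Maps are finite functions, so that equality of maps is extensional. *)
Notation cube_map m n := {ffun cube m -> cube n}.

Definition cid n : cube_map n n := [ffun x => x].

Definition ccomp m n p (g : cube_map n p) (f : cube_map m n) : cube_map m p :=
  [ffun x => g (f x)].

Definition strictly_increasing m n (f : cube_map m n) : Prop :=
  forall x y : cube m, (x < y)%O -> (f x < f y)%O.

(* Coordinates are numbered from 0: coface i a is the coface map usually
   indexed by i + 1, from [n] to [n + 1]; unlift i j is None when j = i. *)
Definition coface n (i : 'I_n.+1) (a : bool) : cube_map n n.+1 :=
  [ffun x : cube n =>
     [tuple if unlift i j is Some k then tnth x k else a | j < n.+1]].

(* The positions i and i + 1 in a cube of dimension n + 1, for i < n. *)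
Definition fst_pos n (i : 'I_n) : 'I_n.+1 := widen_ord (leqnSn n) i.
Definition snd_pos n (i : 'I_n) : 'I_n.+1 := lift ord0 i.

Definition symmetry n (i : 'I_n) : cube_map n.+1 n.+1 :=
  [ffun x : cube n.+1 =>
     [tuple if j == fst_pos i then tnth x (snd_pos i)
            else if j == snd_pos i then tnth x (fst_pos i)
            else tnth x j | j < n.+1]].

Definition gamma n (i : 'I_n) : cube_map n.+1 n.+1 :=
  [ffun x : cube n.+1 =>
     [tuple if j == fst_pos i
            then Order.max (tnth x (fst_pos i)) (tnth x (snd_pos i))
            else if j == snd_pos i
            then Order.min (tnth x (fst_pos i)) (tnth x (snd_pos i))
            else tnth x j | j < n.+1]].

(* Values in the natural numbers extended with infinity, encoded as None. *)
Definition d1 n (x y : cube n) : option nat :=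
  if (x <= y)%O
  then Some (\sum_(i < n) `|(tnth x i : nat) - (tnth y i : nat)|)
  else None.

Definition cotransverse m n (f : cube_map m n) : Prop :=
  strictly_increasing f /\
  forall x y : cube m, d1 x y = Some 1 -> d1 (f x) (f y) = Some 1.

(* All the categories at hand have the cubes [n] as objects, so that they are
   determined by their families of morphisms. *)
Definition cube_family : Type := forall m n : nat, cube_map m n -> Prop.

Definition subfamily (A B : cube_family) : Prop :=
  forall m n (f : cube_map m n), A m n f -> B m n f.

Definition closed_category (A : cube_family) : Prop :=
  (forall n, A n n (cid n)) /\
  (forall m n p (g : cube_map n p) (f : cube_map m n),
     A n p g -> A m n f -> A m p (ccomp g f)).

Inductive generated (G : cube_family) : cube_family :=
| generated_gen m n (f : cube_map m n) : G m n f -> generated G f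
| generated_id n : generated G (cid n)
| generated_comp m n p (g : cube_map n p) (f : cube_map m n) :
    generated G g -> generated G f -> generated G (ccomp g f).

Inductive is_coface : cube_family :=
| IsCoface n (i : 'I_n.+1) (a : bool) : is_coface (coface i a).

Inductive is_symmetry : cube_family :=
| IsSymmetry n (i : 'I_n) : is_symmetry (symmetry i).

Inductive is_gamma : cube_family :=
| IsGamma n (i : 'I_n) : is_gamma (gamma i).

Definition square : cube_family := generated is_coface.

Definition hat_square_S : cube_family := @cotransverse.

Definition category_of_cubes (A : cube_family) : Prop :=
  [/\ closed_category A, subfamily square A & subfamily A hat_square_S].

Definition square_S : cube_family :=
  generated (fun m n f => is_coface f \/ is_symmetry f).

Definition bar_square : cube_family :=
  generated (fun m n f => [\/ is_coface f, is_symmetry f | is_gamma f]).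

Definition hat_square : cube_family := fun m n phi =>
  hat_square_S phi /\
  forall p (delta : cube_map p m), square delta ->
    injective (ccomp phi delta) -> square (ccomp phi delta).

Definition cube_factorization m n (f : cube_map m n)
    (phi : cube_map m n) (psi : cube_map m m) : Prop :=
  [/\ square phi, cotransverse psi & f = ccomp phi psi].

(* Every cotransverse map has a unique factorization; "the map psi in this
   factorization is in A" is rendered as a definite description, so that it is
   meaningful without appealing to that fact. *)
Definition thick (A : cube_family) : Prop :=
  category_of_cubes A /\
  forall m n (f : cube_map m n), A m n f ->
    exists p : cube_map m n * cube_map m m,
      unique (fun q => cube_factorization f q.1 q.2) p /\ A m m p.2.

(* Main.v *)
From mathcomp Require Import all_boot all_order all_algebra.
From mathcomp Require Import perm zify.
Require Import Defs.

Set Implicit Arguments.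
Unset Strict Implicit.
Unset Printing Implicit Defensive.

Import Order.TTheory.
Local Open Scope nat_scope.

(** The weight of a vertex is the number of its coordinates equal to 1. A map
    is cotransverse exactly when it is monotone and shifts all weights by one
    constant ([cotransverseP]), and the maps of [square] are exactly the
    inclusions of faces: the coordinates of the source are inserted, in order,
    at the places [e] and the remaining coordinates are constant ([squareP]).

    Let [f] be cotransverse from [m] to [n]. Its values lie between the images
    of the least and of the greatest vertex, whose weights differ by [m]; so
    exactly [m] coordinates of [f] vary, and [f] corestricts to the face on
    these coordinates ([factorization_exists]). Conversely, in a factorization
    the second map fixes both extreme vertices, because the constant by which it
    shifts weights has to be 0, so the first map agrees with [f] there; and a face is determined by its
    extreme vertices ([factorization_unique]). Thickness of a category
    therefore follows from any one factorization, of each of its maps, whose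
    second map is in the category ([thick_of_factorizations]).

    For the categories given by generators, it is enough that every generator
    composed with a face is a face composed with an endomorphism of the
    category: such exchanges can be chained along a composite
    ([thick_generated]). Symmetries and the maps [gamma] act on two adjacent
    coordinates. If both vary along the face, they vary as two adjacent
    coordinates of the source, and the generator passes through as the
    same generator in the dimension of the source. Otherwise, exchanging a
    constant with its neighbour gives a face again, while sorting a pair with a
    constant entry amounts to always or never exchanging its entries, according
    to that constant, so that the composite is a face in all cases.

    For [hat_square], let [f] factor as [phi] after [psi] and let [psi]
    restricted to a face be one-to-one. Then so is [f] restricted to it, which
    is therefore a face. Factoring the restriction of [psi] gives a second
    factorization of this face, and uniqueness forces its cotransverse part to
    be the identity. *)

(** * Weights of vertices and cotransverse maps *)

Definition weight n (x : cube n) : nat := \sum_(i < n) tnth x i.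

Definition bottom n : cube n := [tuple false | i < n].
Definition top n : cube n := [tuple true | i < n].

Definition lower n (x : cube n) (i : 'I_n) : cube n :=
  [tuple if j == i then false else tnth x j | j < n].

Lemma cube_leP n (x y : cube n) :
  reflect (forall i, tnth x i <= tnth y i) (x <= y)%O.
Proof. by rewrite leEtprod; apply: (iffP forallP) => h i; move: (h i). Qed.

Lemma eq_cube n (x y : cube n) : (forall i, tnth x i = tnth y i) -> x = y.
Proof. exact: eq_from_tnth. Qed.

Lemma bottom_le n (x : cube n) : (bottom n <= x)%O.
Proof. by apply/cube_leP => i; rewrite tnth_mktuple. Qed.

Lemma le_top n (x : cube n) : (x <= top n)%O.
Proof. by apply/cube_leP => i; rewrite tnth_mktuple leq_b1. Qed.

Lemma weight_bottom n : weight (bottom n) = 0.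
Proof. by apply: big1 => i _; rewrite tnth_mktuple. Qed.

Lemma weight_top n : weight (top n) = n.
Proof.
rewrite /weight (eq_bigr (fun=> 1)) => [|i _]; last by rewrite tnth_mktuple.
by rewrite sum1_card card_ord.
Qed.

Lemma leq_weight n (x y : cube n) : (x <= y)%O -> weight x <= weight y.
Proof. by move=> /cube_leP xy; apply: leq_sum. Qed.

(** The weight is strictly increasing on comparable vertices, so that it
    separates them. *)
Lemma le_weight_eq n (x y : cube n) :
  (x <= y)%O -> weight x = weight y -> x = y.
Proof.
move=> /cube_leP xy /eqP; rewrite /weight.
have le_xy i : true -> tnth x i <= tnth y i ?= iff (tnth x i == tnth y i).
  by move: (xy i); case: (tnth x i); case: (tnth y i) => //= _.
have [_ ->] := leqif_sum le_xy.
by move=> /forallP h; apply: eq_cube => i; apply/eqP; exact: (h i).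
Qed.

Lemma weight_max_eq_top n (x : cube n) : n <= weight x -> x = top n.
Proof.
move=> nx; apply: le_weight_eq (le_top x) _; apply/eqP.
by rewrite eqn_leq leq_weight ?le_top // weight_top.
Qed.

Lemma weight_lower n (x : cube n) i :
  tnth x i -> weight x = (weight (lower x i)).+1.
Proof.
move=> xi; rewrite /weight (bigD1 i) //= [in RHS](bigD1 i) //= xi.
rewrite tnth_mktuple eqxx add0n; congr _.+1.
by apply: eq_bigr => j /negbTE ji; rewrite tnth_mktuple ji.
Qed.

Lemma lower_le n (x : cube n) i : (lower x i <= x)%O.
Proof. by apply/cube_leP => j; rewrite tnth_mktuple; case: eqP. Qed.

(** On a comparable pair the coordinates differ in a single direction, so the
    distance is the difference of the weights. *)
Lemma d1_eq1 n (x y : cube n) :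
  d1 x y = Some 1 <-> (x <= y)%O /\ weight y = (weight x).+1.
Proof.
rewrite /d1; case: ifP => [xy|_]; last by split=> [|[]].
rewrite (eq_bigr (fun i => tnth y i - tnth x i)) => [|i _]; last first.
  by rewrite distnEr //; move/cube_leP: xy.
rewrite sumnB => [|i _]; last by move/cube_leP: xy.
rewrite -!/(weight _); have := leq_weight xy.
by split=> [[h]|[_ h]]; [split|congr Some]; lia.
Qed.

(** The vertex [x] is reached from the bottom by a chain of [weight x] steps,
    each of which a cotransverse map sends to a step; conversely a shift of the
    weights by a constant preserves differences of weights. *)
Lemma cotransverseP m n (f : cube_map m n) :
  cotransverse f <->
  (forall x y, (x <= y)%O -> (f x <= f y)%O) /\
  (forall x, weight (f x) = weight (f (bottom m)) + weight x).
Proof.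
split=> [[incr step]|[mono wt]].
  split=> [x y|x]; first by rewrite !le_eqVlt => /predU1P[->|/incr ->];
    rewrite ?eqxx ?orbT.
  move wx: (weight x) => k; elim: k x wx => [|k IHk] x wx.
    rewrite addn0; congr (weight (f _)); apply/esym.
    by apply: le_weight_eq (bottom_le x) _; rewrite weight_bottom.
  have [i xi] : exists i, tnth x i.
    apply/existsP; apply: contra_eqT wx => /existsPn x0.
    by rewrite /weight big1 // => i _; rewrite (negbTE (x0 i)).
  have wxi := weight_lower xi.
  have /step/d1_eq1[_ ->] : d1 (lower x i) x = Some 1.
    by apply/d1_eq1; split; first exact: lower_le.
  by rewrite IHk ?addnS //; lia.
split=> [x y xy|x y /d1_eq1[xy wxy]]; last first.
  by apply/d1_eq1; split; [exact: mono|rewrite [LHS]wt wxy [weight (f x)]wt addnS].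
rewrite lt_neqAle (mono _ _ (ltW xy)) andbT; apply/eqP => fxy.
suff xy_eq : x = y by rewrite xy_eq ltxx in xy.
apply: le_weight_eq (ltW xy) _; apply/(@addnI (weight (f (bottom m)))).
by rewrite -!wt fxy.
Qed.

Lemma cotransverse_id n : cotransverse (cid n).
Proof.
apply/cotransverseP; split=> [x y|x]; rewrite !ffunE //.
by rewrite weight_bottom.
Qed.

Lemma cotransverse_comp m n p (g : cube_map n p) (f : cube_map m n) :
  cotransverse g -> cotransverse f -> cotransverse (ccomp g f).
Proof.
move=> /cotransverseP[gmono gwt] /cotransverseP[fmono fwt].
apply/cotransverseP; split=> [x y xy|x]; rewrite !ffunE.
  exact/gmono/fmono.
by rewrite gwt fwt addnA -gwt.
Qed.

(** All weights are raised by that of the image of the least vertex; since the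
    greatest vertex already has the largest possible weight, this is 0. *)
Lemma cotransverse_bottom n (f : cube_map n n) :
  cotransverse f -> f (bottom n) = bottom n.
Proof.
move=> /cotransverseP[mono wt]; apply/esym/le_weight_eq; first exact: bottom_le.
have := leq_weight (le_top (f (top n))).
by rewrite wt !weight_top weight_bottom; lia.
Qed.

Lemma cotransverse_top n (f : cube_map n n) :
  cotransverse f -> f (top n) = top n.
Proof.
move=> /cotransverseP[mono wt]; apply: weight_max_eq_top.
by rewrite wt weight_top leq_addl.
Qed.

(** * Increasing maps between coordinates *)

Definition increasing m n (e : 'I_m -> 'I_n) : Prop :=
  forall i j : 'I_m, i < j -> e i < e j.

Lemma increasing_inj m n (e : 'I_m -> 'I_n) : increasing e -> injective e.
Proof.
move=> incr i j eij; apply: val_inj => /=.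
by case: (ltngtP i j) => // /incr; rewrite eij ltnn.
Qed.

Lemma increasing_lt m n (e : 'I_m -> 'I_n) (i j : 'I_m) :
  increasing e -> (e i < e j) = (i < j).
Proof.
move=> incr; case: (ltngtP i j) => [/incr // | /incr lt_ji |/val_inj ->].
  by rewrite ltnNge ltnW.
by rewrite ltnn.
Qed.

Lemma sorted_ord_enum n : sorted (fun i j : 'I_n => i < j) (enum 'I_n).
Proof. by rewrite -(@sorted_map _ _ val ltn) val_enum_ord iota_ltn_sorted. Qed.

Lemma increasing_sorted m n (e : 'I_m -> 'I_n) :
  increasing e -> sorted (fun i j : 'I_n => i < j) (codom e).
Proof.
by move=> incr; rewrite sorted_map; apply: sub_sorted (sorted_ord_enum m).
Qed.

(** An increasing map lists its image in order, and a finite set of coordinates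
    has only one such listing. *)
Lemma increasing_codom_eq m n (e e' : 'I_m -> 'I_n) :
  increasing e -> increasing e' -> codom e =i codom e' -> e =1 e'.
Proof.
move=> /increasing_sorted se /increasing_sorted se' eqc i.
suff /eq_in_map/(_ i) : codom e = codom e' by apply; rewrite mem_enum.
apply: irr_sorted_eq se se' eqc => [? ? ?|?]; [exact: ltn_trans|exact: ltnn].
Qed.

Lemma increasing_enumeration m n (S : {set 'I_n}) : #|S| = m ->
  exists2 e : 'I_m -> 'I_n, increasing e & codom e =i S.
Proof.
move=> <-; exists (@enum_val _ (mem S)) => [i j ij|j].
  have j0 := enum_val i; rewrite !(enum_val_nth j0).
  apply: (@sorted_ltn_nth _ (fun i j : 'I_n => i < j)) => //.
  - by move=> ? ? ?; exact: ltn_trans.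
  - rewrite /enum_mem -enumT.
    by apply: sorted_filter (sorted_ord_enum n) => ? ? ?; exact: ltn_trans.
  - by rewrite inE -cardE.
  - by rewrite inE -cardE.
by apply/codomP/idP => [[i ->]|jS];
  [exact: enum_valP|exists (enum_rank_in jS j); rewrite enum_rankK_in].
Qed.

(** * Faces *)

Lemma ltn_lift n (h : 'I_n.+1) (i j : 'I_n) : (lift h i < lift h j) = (i < j).
Proof. by rewrite !ltnNge /= leq_bump2. Qed.

Lemma ccompA m n p q (h : cube_map p q) (g : cube_map n p) (f : cube_map m n) :
  ccomp h (ccomp g f) = ccomp (ccomp h g) f.
Proof. by apply/ffunP => x; rewrite !ffunE. Qed.

Lemma ccomp1 m n (f : cube_map m n) : ccomp f (cid m) = f.
Proof. by apply/ffunP => x; rewrite !ffunE. Qed.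

Lemma ccomp_inj m n p (f : cube_map n p) (g h : cube_map m n) :
  injective f -> ccomp f g = ccomp f h -> g = h.
Proof.
move=> finj /ffunP eq_fgh; apply/ffunP => x; apply: finj.
by move: (eq_fgh x); rewrite !ffunE.
Qed.

(** A face of the cube [n] is encoded by the places [e] of its free coordinates
    and a vertex [l], which supplies the constant coordinates. *)
Record is_face m n (e : 'I_m -> 'I_n) (l : cube n) (f : cube_map m n) : Prop :=
  IsFace {
    face_increasing : increasing e;
    face_in : forall x k, tnth (f x) (e k) = tnth x k;
    face_out : forall x j, j \notin codom e -> tnth (f x) j = tnth l j }.

Definition face_map m n (e : 'I_m -> 'I_n) (l : cube n) : cube_map m n :=
  [ffun x : cube m => [tuple
     if [pick k | e k == j] is Some k then tnth x k else tnth l j | j < n]].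

Lemma face_mapP m n (e : 'I_m -> 'I_n) (l : cube n) :
  increasing e -> is_face e l (face_map e l).
Proof.
move=> incr; split=> // [x k|x j jNe]; rewrite ffunE tnth_mktuple.
  by case: pickP => [k' /eqP/(increasing_inj incr) -> //|/(_ k)/eqP].
by case: pickP => // k /eqP ek; rewrite -ek codom_f in jNe.
Qed.

Lemma face_inj m n (e : 'I_m -> 'I_n) l (f : cube_map m n) :
  is_face e l f -> injective f.
Proof. by case=> _ fin _ x y fxy; apply: eq_cube => k; rewrite -!fin fxy. Qed.

Lemma coface_face n (i : 'I_n.+1) (a : bool) :
  is_face (lift i) [tuple a | j < n.+1] (coface i a).
Proof.
split=> [j k jk|x k|x j jNi].
- by rewrite ltn_lift.
- by rewrite ffunE tnth_mktuple liftK.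
rewrite ffunE !tnth_mktuple; case: unliftP => [k ej|//].
by rewrite ej codom_f in jNi.
Qed.

Lemma id_face n : is_face id (bottom n) (cid n).
Proof.
split=> [i j //|x k|x j]; first by rewrite ffunE.
by rewrite codom_f.
Qed.

Lemma comp_face m n p (e : 'I_n -> 'I_p) l g (e' : 'I_m -> 'I_n) l' f :
  is_face e l g -> is_face e' l' f -> is_face (e \o e') (g l') (ccomp g f).
Proof.
case=> ei gin gout [e'i fin fout]; split=> [i j /e'i/ei //|x k|x j].
  by rewrite ffunE /= gin fin.
rewrite ffunE; case: (boolP (j \in codom e)) => [/codomP[k ->]|/gout ge _].
  move=> kN; rewrite !gin fout //; apply: contra kN => /codomP[i ->].
  by apply/codomP; exists i.
by rewrite !ge.
Qed.

(** A coordinate outside the image of [e] is constant and is inserted by a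
    coface map, which leaves a face of smaller codimension. *)
Lemma face_square m n (e : 'I_m -> 'I_n) l (f : cube_map m n) :
  is_face e l f -> square f.
Proof.
elim: n m e l f => [|n IHn] m e l f [ei fin fout].
  have m0 : m = 0.
    by case: m e {l f ei fin fout} => // m e; have := ltn_ord (e ord0).
  case: _ / (esym m0) e f {ei fin fout} => e f.
  have -> : f = cid 0 by apply/ffunP => x; apply: eq_cube; case.
  exact: generated_id.
case: (boolP [forall j, j \in codom e]) => [/forallP e_onto|].
  have mn : m = n.+1.
    rewrite -[LHS]card_ord -(card_codom (increasing_inj ei)) -[RHS]card_ord.
    exact: eq_card.
  case: _ / (esym mn) e f ei fin fout e_onto => e f ei fin _ e_onto.
  have e_id : e =1 id.
    apply: increasing_codom_eq => // j.
    by rewrite e_onto; apply/esym/codomP; exists j.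
  have -> : f = cid n.+1; last exact: generated_id.
  by apply/ffunP => x; apply: eq_cube => k; rewrite -{1}(e_id k) fin ffunE.
rewrite negb_forall => /existsP[j0 j0Ne].
have e_lift k : {u | e k = lift j0 u}.
  have j0e : j0 != e k by apply: contraNneq j0Ne => ->; exact: codom_f.
  by have [u eu _] := unlift_some j0e; exists u.
pose e' k := sval (e_lift k).
have e'P k : e k = lift j0 (e' k) by rewrite /e'; case: (e_lift k).
pose f' : cube_map m n :=
  [ffun x => [tuple tnth (f x) (lift j0 u) | u < n]].
have -> : f = ccomp (coface j0 (tnth l j0)) f'.
  apply/ffunP => x; apply: eq_cube => j; rewrite !ffunE tnth_mktuple.
  by case: unliftP => [u ->|->]; [rewrite tnth_mktuple|exact: fout].
apply: generated_comp; first by apply: generated_gen.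
apply: (IHn m e' [tuple tnth l (lift j0 u) | u < n]); split=> [i j|x k|x u uN].
- by move=> /ei; rewrite !e'P ltn_lift.
- by rewrite ffunE tnth_mktuple -e'P fin.
rewrite ffunE !tnth_mktuple fout //; apply: contra uN => /codomP[k].
by rewrite e'P => /lift_inj ->; exact: codom_f.
Qed.

Lemma squareP m n (f : cube_map m n) :
  square f <-> exists e l, is_face e l f.
Proof.
split=> [|[e [l]]]; last exact: face_square.
elim=> {m n f} [m n f [k i a]|n|m n p g f _ [e [l gF]] _ [e' [l' fF]]].
- by do 2!eexists; exact: coface_face.
- by do 2!eexists; exact: id_face.
- by do 2!eexists; exact: comp_face gF fF.
Qed.

Lemma square_inj m n (f : cube_map m n) : square f -> injective f.
Proof. by move=> /squareP[e [l]]; exact: face_inj. Qed.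

(** The inserted coordinate contributes the same amount [a] to all weights. *)
Lemma coface_cotransverse n (i : 'I_n.+1) a : cotransverse (coface i a).
Proof.
have weight_coface x : weight (coface i a x) = a + weight x.
  have [_ fin fout] := coface_face i a.
  rewrite /weight (bigD1_ord i) //= fout ?tnth_mktuple; last first.
    by apply/codomP => -[k /eqP]; rewrite (negbTE (neq_lift i k)).
  by congr (_ + _); apply: eq_bigr => k _; rewrite fin.
apply/cotransverseP; split=> [x y /cube_leP xy|x]; last first.
  by rewrite !weight_coface weight_bottom addn0.
apply/cube_leP => j; rewrite !ffunE !tnth_mktuple.
by case: unliftP => // k _; exact: xy.
Qed.

Lemma generated_cotransverse (G : cube_family) :
  subfamily G hat_square_S -> subfamily (generated G) hat_square_S.
Proof.
move=> Gcot m n f; elim=> {m n f} [m n f /Gcot //|n|m n p g f _ ? _ ?].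
  exact: cotransverse_id.
exact: cotransverse_comp.
Qed.

Lemma square_cotransverse : subfamily square hat_square_S.
Proof.
by apply: generated_cotransverse => m n f [k i a]; exact: coface_cotransverse.
Qed.

(** * The factorization of a cotransverse map *)

(** The extreme values of [f] are comparable and their weights differ by [m],
    while their difference of weights counts the coordinates where they
    differ. *)
Lemma cotransverse_free_coordinates m n (f : cube_map m n) : cotransverse f ->
  #|[set j | tnth (f (bottom m)) j != tnth (f (top m)) j]| = m.
Proof.
move=> /cotransverseP[mono wt]; have := wt (top m); rewrite weight_top.
have /cube_leP le_f := mono _ _ (bottom_le (top m)).
set S := [set j | _]; suff -> : weight (f (top m)) = weight (f (bottom m)) + #|S|.
  exact: addnI.
rewrite -sum1_card [X in _ + X]big_mkcond -big_split /=; apply: eq_bigr => j _.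
by move: (le_f j); rewrite inE; do 2!case: (tnth _ j).
Qed.

(** The first map is the face between the extreme values of [f]: the values of
    [f] lie between these, so they agree with them on all other coordinates.
    The second map is [f] read on the free coordinates. *)
Lemma factorization_exists m n (f : cube_map m n) : cotransverse f ->
  exists phi psi, cube_factorization f phi psi.
Proof.
move=> fcot; have [e ei eS] :=
  increasing_enumeration (cotransverse_free_coordinates fcot).
have [fmono fwt] := (cotransverseP f).1 fcot.
pose phi := face_map e (f (bottom m)).
pose psi : cube_map m m := [ffun x => [tuple tnth (f x) (e k) | k < m]].
have phiF : is_face e (f (bottom m)) phi := face_mapP _ ei.
have phisq := face_square phiF; have [_ phiin phiout] := phiF.
have fE : f = ccomp phi psi.
  apply/ffunP => x; apply: eq_cube => j; rewrite ffunE.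
  case: (boolP (j \in codom e)) => [/codomP[k ->]|jN].
    by rewrite phiin ffunE tnth_mktuple.
  rewrite phiout //; move: jN; rewrite eS inE negbK => /eqP fj.
  have /cube_leP/(_ j) := fmono _ _ (bottom_le x).
  have /cube_leP/(_ j) := fmono _ _ (le_top x).
  by rewrite -fj; do 2!case: (tnth _ j).
exists phi, psi; split=> //; apply/cotransverseP; split=> [x y xy|x].
  apply/cube_leP => k; rewrite !ffunE !tnth_mktuple.
  by have /cube_leP := fmono _ _ xy.
have [_ phiwt] := (cotransverseP phi).1 (square_cotransverse phisq).
have fEx y : f y = phi (psi y) by rewrite {1}fE ffunE.
(* As [f] and [phi] both shift weights by a constant, so does [psi]. *)
have := fwt x; rewrite fEx (fEx (bottom m)) [weight (phi (psi x))]phiwt.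
by rewrite [weight (phi (psi (bottom m)))]phiwt -addnA => /addnI.
Qed.

(** A face is the interval between its extreme vertices: its free coordinates
    are those where the two differ. *)
Lemma face_eq m n (e e' : 'I_m -> 'I_n) l l' (phi phi' : cube_map m n) :
  is_face e l phi -> is_face e' l' phi' ->
  phi (bottom m) = phi' (bottom m) -> phi (top m) = phi' (top m) -> phi = phi'.
Proof.
move=> phiF phi'F eq_bot eq_top.
have codomE (d : 'I_m -> 'I_n) (k : cube n) (g : cube_map m n) j :
    is_face d k g ->
    (j \in codom d) = (tnth (g (bottom m)) j != tnth (g (top m)) j).
  case=> _ gin gout; case: (boolP (j \in codom d)) => [/codomP[i ->]|jN].
    by rewrite !gin !tnth_mktuple.
  by rewrite !gout // eqxx.
have [ei phiin phiout] := phiF; have [e'i phi'in phi'out] := phi'F.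
have eq_codom : codom e =i codom e'.
  by move=> j; rewrite (codomE _ _ _ _ phiF) (codomE _ _ _ _ phi'F) eq_bot eq_top.
have ee' := increasing_codom_eq ei e'i eq_codom.
apply/ffunP => x; apply: eq_cube => j.
case: (boolP (j \in codom e)) => [/codomP[k ->]|jN].
  by rewrite phiin ee' phi'in.
have jN' : j \notin codom e' by rewrite -eq_codom.
rewrite phiout // phi'out // -(phiout (bottom m)) // -(phi'out (bottom m)) //.
by rewrite eq_bot.
Qed.

(** As [psi] and [psi'] fix the extreme vertices, both faces have the extreme
    values of [f] as extreme vertices; faces being one-to-one, the second maps
    then agree too. *)
Lemma factorization_unique m n (f : cube_map m n) phi psi phi' psi' :
  cube_factorization f phi psi -> cube_factorization f phi' psi' ->
  phi = phi' /\ psi = psi'.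
Proof.
case=> phisq psicot fE [phi'sq psi'cot fE'].
suff eq_phi : phi = phi'.
  split=> //; apply: (ccomp_inj (square_inj phisq)).
  by rewrite -fE fE' eq_phi.
have [e [l phiF]] := (squareP phi).1 phisq.
have [e' [l' phi'F]] := (squareP phi').1 phi'sq.
apply: face_eq phiF phi'F _ _.
  move: fE'; rewrite fE => /ffunP/(_ (bottom m)).
  by rewrite !ffunE !cotransverse_bottom.
move: fE'; rewrite fE => /ffunP/(_ (top m)).
by rewrite !ffunE !cotransverse_top.
Qed.

(** Uniqueness lets the membership in [A] be tested on a factorization of
    one's choice. *)
Lemma thick_of_factorizations (A : cube_family) : category_of_cubes A ->
  (forall m n (f : cube_map m n), A m n f ->
     exists phi psi, cube_factorization f phi psi /\ A m m psi) ->
  thick A.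
Proof.
move=> Acat Afact; split=> // m n f /Afact[phi [psi [fact Apsi]]].
exists (phi, psi); split=> //; split=> // -[phi' psi'] fact'.
by have [-> ->] := factorization_unique fact fact'.
Qed.

(** * Thickness of a category given by generators *)

(** The exchange rule for [g] against faces. Unlike the factorization property
    of [g] alone, which is the case of the identity face, it is inherited by
    composites. *)
Definition pushes_past_faces (A : cube_family) n p (g : cube_map n p) : Prop :=
  forall m (phi : cube_map m n), square phi ->
    exists (phi' : cube_map m p) psi,
      [/\ square phi', A m m psi & ccomp g phi = ccomp phi' psi].

Lemma square_pushes (A : cube_family) n p (g : cube_map n p) :
  closed_category A -> square g -> pushes_past_faces A g.
Proof.
move=> [Aid _] gsq m phi phisq; exists (ccomp g phi), (cid m).
by rewrite ccomp1; split=> //; exact: generated_comp.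
Qed.

Lemma generated_closed (G : cube_family) : closed_category (generated G).
Proof. by split; [exact: generated_id|exact: generated_comp]. Qed.

Lemma thick_generated (G : cube_family) :
  subfamily is_coface G -> subfamily G hat_square_S ->
  (forall n p (g : cube_map n p), G n p g ->
     pushes_past_faces (generated G) g) ->
  thick (generated G).
Proof.
move=> Gcoface Gcot Gpush; have Acot := generated_cotransverse Gcot.
apply: thick_of_factorizations.
  split=> //; first exact: generated_closed.
  move=> m n f; elim=> {m n f} [m n f /Gcoface|n|m n p g f _ ? _ ?].
  - exact: generated_gen.
  - exact: generated_id.
  - exact: generated_comp.
move=> m n f Af; suff : pushes_past_faces (generated G) f.
  move=> /(_ _ (cid m) (generated_id _ m)); rewrite ccomp1.
  move=> [phi [psi [phisq Apsi fE]]]; exists phi, psi; split=> //.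
  by split=> //; exact: Acot.
elim: Af => {m n f} [m n f /Gpush //|n|m n p g f _ IHg _ IHf] q phi phisq.
  by apply: square_pushes phisq; [exact: generated_closed|exact: generated_id].
have [phi1 [psi1 [phi1sq Apsi1 E1]]] := IHf _ _ phisq.
have [phi2 [psi2 [phi2sq Apsi2 E2]]] := IHg _ _ phi1sq.
exists phi2, (ccomp psi2 psi1); split=> //; first exact: generated_comp.
by rewrite -ccompA E1 ccompA E2 ccompA.
Qed.

(** * Maps acting on two adjacent coordinates *)

(** Symmetries and the maps [gamma] are treated together, as a binary operation
    [t] applied at two positions. The positions are arbitrary, rather than
    given by the index of the generator, since images and preimages of adjacent
    positions under [e] are needed. *)
Definition local_map (t : bool -> bool -> bool * bool) n (p q : 'I_n) :
    cube_map n n :=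
  [ffun x : cube n => [tuple
     if j == p then (t (tnth x p) (tnth x q)).1
     else if j == q then (t (tnth x p) (tnth x q)).2
     else tnth x j | j < n]].

Definition swap_bits (a b : bool) : bool * bool := (b, a).
Definition sort_bits (a b : bool) : bool * bool :=
  (Order.max a b, Order.min a b).

Lemma symmetry_local n (i : 'I_n) :
  symmetry i = local_map swap_bits (fst_pos i) (snd_pos i).
Proof. by []. Qed.

Lemma gamma_local n (i : 'I_n) :
  gamma i = local_map sort_bits (fst_pos i) (snd_pos i).
Proof. by []. Qed.

(** Presents the action on adjacent positions as one of the generators; the
    predicate [P] absorbs the fact that the dimension has to be seen as a
    successor. *)
Lemma local_map_adjacent t (P : forall n, cube_map n n -> Prop) :
  (forall n (i : 'I_n), P n.+1 (local_map t (fst_pos i) (snd_pos i))) ->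
  forall n (p q : 'I_n), q = p.+1 :> nat -> P n (local_map t p q).
Proof.
move=> Pt [|n] p q; first by case: p.
move=> qp; have pn : p < n by rewrite -ltnS -qp.
have -> : p = fst_pos (Ordinal pn) by apply: val_inj.
have -> : q = snd_pos (Ordinal pn) by apply: val_inj.
exact: Pt.
Qed.

Lemma local_map_cotransverse (t : bool -> bool -> bool * bool) n (p q : 'I_n) :
  p != q ->
  (forall a b a' b' : bool, a <= a' -> b <= b' ->
     (t a b).1 <= (t a' b').1 /\ (t a b).2 <= (t a' b').2) ->
  (forall a b : bool, (t a b).1 + (t a b).2 = a + b) ->
  cotransverse (local_map t p q).
Proof.
move=> pq tmono tsum.
have wt x : weight (local_map t p q x) = weight x.
  have qp : q != p by rewrite eq_sym.
  rewrite /weight (bigD1 p) //= (bigD1 q) //= [RHS](bigD1 p) //=.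
  rewrite [in RHS](bigD1 q) //= !ffunE !tnth_mktuple !eqxx (negbTE qp).
  rewrite !addnA tsum; congr (_ + _); apply: eq_bigr => j /andP[jp jq].
  by rewrite tnth_mktuple (negbTE jp) (negbTE jq).
apply/cotransverseP; split=> [x y /cube_leP xy|x]; last first.
  by rewrite !wt weight_bottom.
apply/cube_leP => j; rewrite !ffunE !tnth_mktuple.
have [t1 t2] := tmono _ _ _ _ (xy p) (xy q).
by case: ifP => // _; case: ifP.
Qed.

Lemma symmetry_cotransverse n (i : 'I_n) : cotransverse (symmetry i).
Proof.
rewrite symmetry_local; apply: local_map_cotransverse.
- by rewrite -val_eqE /= /bump; lia.
- by [].
- by move=> [] [].
Qed.

Lemma gamma_cotransverse n (i : 'I_n) : cotransverse (gamma i).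
Proof.
rewrite gamma_local; apply: local_map_cotransverse.
- by rewrite -val_eqE /= /bump; lia.
- by move=> [] [] [] [].
- by move=> [] [].
Qed.

(** When both positions are free on the face, the operation is carried out on
    the corresponding coordinates of the source. *)
Lemma local_map_face t m n (e : 'I_m -> 'I_n) l (phi : cube_map m n) a b :
  is_face e l phi ->
  ccomp (local_map t (e a) (e b)) phi = ccomp phi (local_map t a b).
Proof.
move=> [ei phiin phiout]; apply/ffunP => x; apply: eq_cube => j.
rewrite !ffunE tnth_mktuple.
case: (boolP (j \in codom e)) => [/codomP[k ->]|jN].
  by rewrite !phiin !tnth_mktuple !(inj_eq (increasing_inj ei)).
have /negbTE -> : j != e a by apply: contraNneq jN => ->; exact: codom_f.
have /negbTE -> : j != e b by apply: contraNneq jN => ->; exact: codom_f.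
by rewrite !phiout.
Qed.

(** A coordinate strictly between [a] and [b] would be sent strictly between
    two adjacent positions. *)
Lemma increasing_adjacent m n (e : 'I_m -> 'I_n) (a b : 'I_m) :
  increasing e -> e b = (e a).+1 :> nat -> b = a.+1 :> nat.
Proof.
move=> ei eab; have ab : a < b by rewrite -(increasing_lt _ _ ei) eab.
apply/eqP; rewrite eqn_leq ab andbT leqNgt; apply/negP => a1b.
have cm : a.+1 < m by apply: ltn_trans a1b _.
have /ei ac : a < Ordinal cm by [].
have /ei cb : Ordinal cm < b by [].
lia.
Qed.

(** Exchanging the positions [p] and [q] transposes the places of the face.
    The transposition reverses the order only of the pair [p], [q], which is
    not wholly in the image of [e], so the new places are still increasing. *)
Lemma swap_face m n (e : 'I_m -> 'I_n) l (phi : cube_map m n) (p q : 'I_n) :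
  is_face e l phi -> q = p.+1 :> nat ->
  ~~ ((p \in codom e) && (q \in codom e)) ->
  square (ccomp (local_map swap_bits p q) phi).
Proof.
move=> [ei phiin phiout] qp pqN.
have swapE x j : tnth (local_map swap_bits p q x) j = tnth x (tperm p q j).
  by rewrite ffunE tnth_mktuple; case: tpermP => [->|->|/eqP/negbTE-> /eqP/negbTE->];
    rewrite ?eqxx //; case: eqP => // ->.
apply: (@face_square _ _ (tperm p q \o e) [tuple tnth l (tperm p q j) | j < n]).
split=> [i j /ei ij|x k|x j jN].
- have ijN : ~ (e i = p :> nat /\ e j = q :> nat).
    move=> [/val_inj eip /val_inj ejq]; move/negP: pqN; apply.
    by rewrite -eip -ejq !codom_f.
  by rewrite /= !permE /= -!val_eqE /=; do 4?case: eqP => ?; lia.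
- by rewrite ffunE swapE /= tpermK phiin.
rewrite ffunE swapE tnth_mktuple phiout //; apply: contra jN => /codomP[k jk].
by apply/codomP; exists k; rewrite /= -jk tpermK.
Qed.

(** Sorting in decreasing order a pair whose second entry is the constant 1,
    or whose first entry is the constant 0, always amounts to exchanging the
    entries; with the other constant it never changes the pair. *)
Lemma sort_face m n (e : 'I_m -> 'I_n) l (phi : cube_map m n) (p q : 'I_n) :
  is_face e l phi -> q = p.+1 :> nat ->
  ~~ ((p \in codom e) && (q \in codom e)) ->
  square (ccomp (local_map sort_bits p q) phi).
Proof.
move=> phiF qp pqN; have [ei phiin phiout] := phiF.
have swapsq := swap_face phiF qp pqN; have phisq := face_square phiF.
move: pqN; rewrite negb_and => /orP[pN|qN].
  suff -> : ccomp (local_map sort_bits p q) phi =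
    if tnth l p then phi else ccomp (local_map swap_bits p q) phi by case: ifP.
  apply/ffunP => x; apply: eq_cube => j; have := phiout x p pN.
  by case: (tnth l p) => phip; rewrite !ffunE !tnth_mktuple phip;
    case: (eqVneq j p) => [?|_]; try case: (eqVneq j q) => [?|_]; subst;
    rewrite ?phip //=; case: (tnth _ q).
suff -> : ccomp (local_map sort_bits p q) phi =
  if tnth l q then ccomp (local_map swap_bits p q) phi else phi by case: ifP.
apply/ffunP => x; apply: eq_cube => j; have := phiout x q qN.
by case: (tnth l q) => phiq; rewrite !ffunE !tnth_mktuple phiq;
  case: (eqVneq j p) => [?|_]; try case: (eqVneq j q) => [?|_]; subst;
  rewrite ?phiq //=; case: (tnth _ p).
Qed.

Lemma local_map_pushes t (A : cube_family) n (i : 'I_n) :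
  closed_category A ->
  (forall k (j : 'I_k), A _ _ (local_map t (fst_pos j) (snd_pos j))) ->
  (forall m (e : 'I_m -> 'I_n.+1) l phi, is_face e l phi ->
     ~~ ((fst_pos i \in codom e) && (snd_pos i \in codom e)) ->
     square (ccomp (local_map t (fst_pos i) (snd_pos i)) phi)) ->
  pushes_past_faces A (local_map t (fst_pos i) (snd_pos i)).
Proof.
move=> [Aid _] At tsq m phi /squareP[e [l phiF]].
case: (boolP ((fst_pos i \in codom e) && (snd_pos i \in codom e))); last first.
  move=> /(tsq _ _ _ _ phiF) sq.
  by exists (ccomp (local_map t (fst_pos i) (snd_pos i)) phi), (cid m);
    rewrite ccomp1.
move=> /andP[/codomP[a ea] /codomP[b eb]].
exists phi, (local_map t a b); split; first exact: face_square phiF.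
  apply: (local_map_adjacent (P := fun n => A n n)) => //.
  by apply: (increasing_adjacent (face_increasing phiF)); rewrite -ea -eb.
by rewrite ea eb (local_map_face _ _ _ phiF).
Qed.

Lemma symmetry_pushes (A : cube_family) n (i : 'I_n) :
  closed_category A -> subfamily is_symmetry A ->
  pushes_past_faces A (symmetry i).
Proof.
move=> Acat Asym; rewrite symmetry_local; apply: local_map_pushes => // [k j|].
  exact: Asym (IsSymmetry j).
by move=> m e l phi phiF; exact: swap_face phiF _.
Qed.

Lemma gamma_pushes (A : cube_family) n (i : 'I_n) :
  closed_category A -> subfamily is_gamma A ->
  pushes_past_faces A (gamma i).
Proof.
move=> Acat Agam; rewrite gamma_local; apply: local_map_pushes => // [k j|].
  exact: Agam (IsGamma j).
by move=> m e l phi phiF; exact: sort_face phiF _.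
Qed.

(** * The four categories *)

Lemma thick_square : thick square.
Proof.
apply: thick_generated => // [m n f [k i a]|n p g gcof].
  exact: coface_cotransverse.
by apply: square_pushes; [exact: generated_closed|exact: generated_gen].
Qed.

Lemma thick_square_S : thick square_S.
Proof.
apply: thick_generated => [m n f|m n f|n p g]; first by left.
  case=> -[k i]; [move=> a; exact: coface_cotransverse|].
  exact: symmetry_cotransverse.
case=> [gcof|[k i]].
  by apply: square_pushes; [exact: generated_closed|exact: generated_gen].
apply: symmetry_pushes; first exact: generated_closed.
by move=> ? ? ? ?; apply: generated_gen; right.
Qed.

Lemma thick_bar_square : thick bar_square.
Proof.
apply: thick_generated => [m n f|m n f|n p g]; first by constructor 1.
  case=> -[k i]; [move=> a; exact: coface_cotransverse| |].
    exact: symmetry_cotransverse.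
  exact: gamma_cotransverse.
case=> [gcof|[k i]|[k i]].
- by apply: square_pushes; [exact: generated_closed|exact: generated_gen].
- apply: symmetry_pushes; first exact: generated_closed.
  by move=> ? ? ? ?; apply: generated_gen; constructor 2.
- apply: gamma_pushes; first exact: generated_closed.
  by move=> ? ? ? ?; apply: generated_gen; constructor 3.
Qed.

Lemma ccomp_injectiveR m n p (g : cube_map n p) (f : cube_map m n) :
  injective (ccomp g f) -> injective f.
Proof. by move=> gfinj x y fxy; apply: gfinj; rewrite !ffunE fxy. Qed.

(** Stability under composition: if [g] after [f] after a face is one-to-one,
    then [f] after the face is too, hence is itself a face to which the
    condition on [g] applies. *)
Lemma hat_square_category : category_of_cubes hat_square.
Proof.
split; last by move=> m n f [].
  split=> [n|m n p g f [gcot gsq] [fcot fsq]].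
    split=> [|m d dsq _]; first exact: cotransverse_id.
    by have -> : ccomp (cid n) d = d by apply/ffunP => x; rewrite !ffunE.
  split=> [|q d dsq]; first exact: cotransverse_comp.
  rewrite -ccompA => gfdinj.
  by apply: gsq => //; apply: fsq => //; exact: ccomp_injectiveR gfdinj.
move=> m n f fsq; split=> [|p d dsq _]; first exact: square_cotransverse.
exact: generated_comp.
Qed.

Lemma thick_hat_square : thick hat_square.
Proof.
apply: thick_of_factorizations hat_square_category _ => m n f [fcot fsq].
have [phi [psi fact]] := factorization_exists fcot; exists phi, psi.
split=> //; have [phisq psicot fE] := fact; split=> // p d dsq psidinj.
have fdsq : square (ccomp f d).
  apply: fsq => // x y; rewrite fE -ccompA ffunE [RHS]ffunE.
  by move=> /(square_inj phisq)/psidinj.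
have psidcot := cotransverse_comp psicot (square_cotransverse dsq).
have [phi1 [psi1 [phi1sq psi1cot psidE]]] := factorization_exists psidcot.
(* The face [ccomp f d] also has the factorization with identity second map. *)
have [_ psi1_id] : ccomp phi phi1 = ccomp f d /\ psi1 = cid p.
  apply: (@factorization_unique _ _ (ccomp f d)); split=> //.
  - exact: generated_comp.
  - by rewrite fE -ccompA psidE ccompA.
  - exact: cotransverse_id.
  - by rewrite ccomp1.
by rewrite psidE psi1_id ccomp1.
Qed.

Theorem theorem2p16 :
  thick square /\ thick square_S /\ thick hat_square /\ thick bar_square.
Proof.
split; first exact: thick_square.
split; first exact: thick_square_S.
by split; [exact: thick_hat_square|exact: thick_bar_square].
Qed.
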